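(* The multivariate Haar system (normalized in $L_1$) is not a quasi-greedy basis of $L_1[0,1]^d$.
   Context: $L_1[0,1]^d$ ($d\ge1$) is $L_1([0,1]^d)$ with Lebesgue measure $\mu$ and norm $\|f\|=\int|f|$. Haar system. For $n\ge 0$ let $\mathcal D_n$ be the set of dyadic intervals $[k2^{-n},(k+1)2^{-n})$, $0\le k<2^n$; $\mathcal D_n^d=\mathcal D_n\times\cdots\times\mathcal D_n$ and $\mathcal D^d=\bigcup_{n\ge 0}\mathcal D_n^d$. For $a<b$ put $r^{(0)}_{[a,b)}=\frac{\chi_{[a,b)}}{b-a}$ and $r^{(1)}_{[a,b)}=\frac{\chi_{[a,(a+b)/2)}-\chi_{[(a+b)/2,b)}}{b-a}$. For $I=I_1\times\cdots\times I_d\in\mathcal D^d$ and $1\le j\le 2^d-1$ with $j=\sum_{k=1}^d\epsilon_k2^{d-k}$, $\epsilon_k\in\{0,1\}$, put $h_I^{(j)}(x)=\prod_{k=1}^d r_{I_k}^{(\epsilon_k)}(x_k)$. The multivariate Haar system consists of all $h_I^{(j)}$ together with $\chi_{[0,1)^d}$; the corresponding coefficients of $f$ are $c_I^{(j)}(f)=\mu(I)\int_I f h_I^{(j)}$ and $\int f$. Quasi-greedy. For a semi-normalized Schauder basis $(\psi_n)$ of a Banach space $X$ with coefficients $(c_n(f))$, an $n$-th greedy approximant of $f$ is $G_n(f)=\sum_{i\in\Lambda}c_i(f)\psi_i$, where $\Lambda$ is a set of $n$ indices with $\min_{i\in\Lambda}|c_i(f)|\ge\max_{i\notin\Lambda}|c_i(f)|$.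 The basis is quasi-greedy if there is $K<\infty$ such that $\|G_n(f)\|\le K\|f\|$ for all $f\in X$, all $n\ge1$ and all $n$-th greedy approximants. *)

(* Defs.v *)
From HB Require Import structures.
From mathcomp Require Import all_boot all_order all_algebra finmap.
From mathcomp Require Import all_classical all_reals all_analysis.

Set Implicit Arguments.
Unset Strict Implicit.
Unset Printing Implicit Defensive.

Import Order.TTheory GRing.Theory Num.Theory numFieldNormedType.Exports.

Local Open Scope classical_set_scope.
Local Open Scope ring_scope.

(** R^d carries the product sigma-algebra of [d.-tuple], i.e. the Borel sets.
    The library has no d-fold product measure, so the Lebesgue measure on R^d
    is built here by induction on d: R^0 is a point of mass 1, and the measure
    on R^(d+1) is the product of [lebesgue_measure] on R with the measure on
    R^d. It is characterized by its values on boxes, see [lebesgue_euclidean_box]. *)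
Notation euclidean R d := (d.-tuple (measurableTypeR R)).

Definition coord_cons (R : realType) (d : nat)
    (x : measurableTypeR R * euclidean R d) : euclidean R d.+1 :=
  [tuple of x.1 :: x.2].

Definition coord_uncons (R : realType) (d : nat) (x : euclidean R d.+1) :
    measurableTypeR R * euclidean R d :=
  (thead x, [tuple of behead x]).

Lemma coord_consK (R : realType) (d : nat) :
  cancel (@coord_cons R d) (@coord_uncons R d).
Proof.
move=> [a t]; rewrite /coord_uncons /coord_cons; congr pair.
by apply/val_inj.
Qed.

Lemma measurable_coord_cons (R : realType) (d : nat) :
  measurable_fun setT (@coord_cons R d).
Proof. exact: (measurable_cons measurable_fst measurable_snd). Qed.

Lemma measurable_coord_uncons (R : realType) (d : nat) :
  measurable_fun setT (@coord_uncons R d).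
Proof.
apply/measurable_fun_pairP; split.
  exact: (measurable_tnth ord0).
exact: measurable_behead.
Qed.

Definition lebesgue_cons (R : realType) (d : nat)
    (m : {sigma_finite_measure set (euclidean R d) -> \bar R}) :
    set (euclidean R d.+1) -> \bar R :=
  pushforward (@lebesgue_measure R \x m)%E (@coord_cons R d).

Lemma lebesgue_cons0 (R : realType) (d : nat)
    (m : {sigma_finite_measure set (euclidean R d) -> \bar R}) :
  lebesgue_cons m set0 = 0%E.
Proof. by rewrite /lebesgue_cons /pushforward preimage_set0 measure0. Qed.

Lemma lebesgue_cons_ge0 (R : realType) (d : nat)
    (m : {sigma_finite_measure set (euclidean R d) -> \bar R}) A :
  (0 <= lebesgue_cons m A)%E.
Proof. by rewrite /lebesgue_cons /pushforward measure_ge0. Qed.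

Lemma lebesgue_cons_sigma_additive (R : realType) (d : nat)
    (m : {sigma_finite_measure set (euclidean R d) -> \bar R}) :
  semi_sigma_additive (lebesgue_cons m).
Proof.
have mc := @measurable_coord_cons R d.
rewrite /lebesgue_cons; exact: measure_semi_sigma_additive.
Qed.

HB.instance Definition _ (R : realType) (d : nat)
    (m : {sigma_finite_measure set (euclidean R d) -> \bar R}) :=
  isMeasure.Build _ _ _ (lebesgue_cons m) (lebesgue_cons0 m)
    (lebesgue_cons_ge0 m) (@lebesgue_cons_sigma_additive R d m).

Lemma lebesgue_cons_sigma_finite (R : realType) (d : nat)
    (m : {sigma_finite_measure set (euclidean R d) -> \bar R}) :
  sigma_finite setT (lebesgue_cons m).
Proof.
have /sigma_finiteP[F [UF ndF Foo]] := sigma_finiteT (@lebesgue_measure R).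
have /sigma_finiteP[G [UG ndG Goo]] := sigma_finiteT m.
exists (fun n => @coord_uncons R d @^-1` (F n `*` G n)).
  rewrite -preimage_bigcup (_ : \bigcup_n _ = setT) ?preimage_setT//.
  apply/seteqP; split=> // -[x y] _.
  have [k _ Fk] : (\bigcup_k F k) x by rewrite -UF.
  have [l _ Gl] : (\bigcup_k G k) y by rewrite -UG.
  exists (maxn k l) => //; split.
    by move: x Fk; exact/subsetPset/ndF/leq_maxl.
  by move: y Gl; exact/subsetPset/ndG/leq_maxr.
move=> n; have [mF Fn] := Foo n; have [mG Gn] := Goo n; split.
  rewrite -[X in measurable X]setTI.
  by apply: measurable_coord_uncons => //; exact: measurableX.
rewrite /lebesgue_cons /pushforward -comp_preimage.
rewrite (_ : _ \o _ = id); last by apply/funext => x /=; rewrite coord_consK.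
by rewrite preimage_id product_measure1E// lte_mul_pinfty// ge0_fin_numE.
Qed.

HB.instance Definition _ (R : realType) (d : nat)
    (m : {sigma_finite_measure set (euclidean R d) -> \bar R}) :=
  Measure_isSigmaFinite.Build _ _ _ (lebesgue_cons m)
    (lebesgue_cons_sigma_finite m).

Fixpoint lebesgue_euclidean (R : realType) (d : nat) :
    {sigma_finite_measure set (euclidean R d) -> \bar R} :=
  if d is d'.+1 then lebesgue_cons (lebesgue_euclidean R d')
  else \d_([tuple] : euclidean R 0).

Lemma lebesgue_euclidean_box (R : realType) (d : nat)
    (A : 'I_d -> set (measurableTypeR R)) :
  (forall k, measurable (A k)) ->
  lebesgue_euclidean R d [set x | forall k, A k (tnth x k)] =
  (\prod_(k < d) lebesgue_measure (A k))%E.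
Proof.
elim: d A => [|d IH] A mA.
  rewrite big_ord0 /= diracE mem_set// => -[] //.
rewrite big_ord_recl -IH//.
rewrite -product_measure1E//; last first.
  rewrite (_ : [set _ | _] =
     \bigcap_(k in [set: 'I_d]) ((fun x => tnth x k) @^-1` A (lift ord0 k))).
    apply: fin_bigcap_measurable => // k _.
    by rewrite -[X in measurable X]setTI; exact: measurable_tnth.
  by apply/seteqP; split=> [x xA k _|x xA k]; exact: xA.
rewrite /= /lebesgue_cons /pushforward; congr product_measure1.
apply/seteqP; split => [[a t] /= H|[a t] [/= H0 H] k].
  split; first exact: (H ord0).
  by move=> k /=; have := H (lift ord0 k); rewrite tnthS.
have [->//|k0] := eqVneq k ord0.
case: (unliftP ord0 k) k0 => [j ->|->]; last by rewrite eqxx.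
by move=> _; rewrite tnthS.
Qed.

(** [0,1]^d and L_1[0,1]^d. Functions are representatives: they live on R^d,
    only their restriction to the cube matters, and [L1norm] is the seminorm
    whose kernel is almost-everywhere equality to 0 on the cube. *)
Definition unit_cube (R : realType) (d : nat) : set (euclidean R d) :=
  [set x | forall k, tnth x k \in `[0, 1]].
Arguments unit_cube : clear implicits.

Definition L1 (R : realType) (d : nat) : set (euclidean R d -> R) :=
  [set f | (lebesgue_euclidean R d).-integrable (unit_cube R d) (EFin \o f)].
Arguments L1 : clear implicits.

Definition L1norm (R : realType) (d : nat) (f : euclidean R d -> R) : R :=
  \int[lebesgue_euclidean R d]_(x in unit_cube R d) `|f x|.
Arguments L1norm : clear implicits.

Definition dyadic_lo (R : realType) (n : nat) (k : 'I_(2 ^ n)) : R :=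
  k%:R / 2 ^+ n.

Definition dyadic_hi (R : realType) (n : nat) (k : 'I_(2 ^ n)) : R :=
  k.+1%:R / 2 ^+ n.

Definition dyadic_cube (R : realType) (d n : nat)
    (Q : {ffun 'I_d -> 'I_(2 ^ n)}) : set (euclidean R d) :=
  [set x | forall k, tnth x k \in `[dyadic_lo R (Q k), dyadic_hi R (Q k)[].
Arguments dyadic_cube R {d n} Q _.

Definition haar_factor (R : realType) (e : bool) (a b x : R) : R :=
  if e then
    (\1_`[a, (a + b) / 2[%classic x - \1_`[(a + b) / 2, b[%classic x) / (b - a)
  else \1_`[a, b[%classic x / (b - a).

(** Coordinates are numbered from 0 here, so the (k+1)-st binary digit of j,
    most significant first among d digits, has weight 2^(d - (k+1)). *)
Definition haar_digit (d : nat) (j : 'I_(2 ^ d)) (k : 'I_d) : bool :=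
  odd (j %/ 2 ^ (d - k.+1)).

(** [None] is the constant function; [Some (n; (Q, j))] is h_Q^(j) with Q a
    dyadic cube of level n and 1 <= j <= 2^d - 1. *)
Definition haar_index (d : nat) : choiceType :=
  option {n : nat &
    ({ffun 'I_d -> 'I_(2 ^ n)} * {j : 'I_(2 ^ d) | (0 < j)%N})%type}.

Definition haar (R : realType) (d : nat) (i : haar_index d) :
    euclidean R d -> R :=
  match i with
  | None => \1_[set x | forall k, tnth x k \in `[0, 1[]
  | Some (existT n (Q, j)) => fun x =>
      \prod_(k < d) haar_factor (haar_digit (val j) k)
        (dyadic_lo R (Q k)) (dyadic_hi R (Q k)) (tnth x k)
  end.
Arguments haar R {d} i x.

Definition haar_coef (R : realType) (d : nat) (f : euclidean R d -> R)
    (i : haar_index d) : R :=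
  match i with
  | None => \int[lebesgue_euclidean R d]_(x in unit_cube R d) f x
  | Some (existT n (Q, j)) =>
      fine (lebesgue_euclidean R d (dyadic_cube R Q)) *
      \int[lebesgue_euclidean R d]_(x in dyadic_cube R Q) (f x * haar R i x)
  end.
Arguments haar_coef R {d} f i.

(** Greedy approximation in the subspace [X] of [V], (semi)normed by [norm],
    with respect to the system [psi] with coefficient functionals [c]. Nothing
    below depends on the order in which a basis is enumerated, so any index
    type is allowed. That [psi] is a semi-normalized Schauder basis with
    coefficients [c] is not part of [quasi_greedy], so that its negation can
    only mean that the bound on greedy approximants fails. *)
Definition greedy_set (R : realType) (J : choiceType) (a : J -> R) (n : nat)
    (A : {fset J}) : Prop :=
  #|` A|%fset = n /\
  forall i j, i \in A -> j \notin A -> `|a j| <= `|a i|.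

Definition greedy_approximant (R : realType) (V : lmodType R) (J : choiceType)
    (psi : J -> V) (c : V -> J -> R) (n : nat) (f g : V) : Prop :=
  exists2 A : {fset J}, greedy_set (c f) n A & g = \sum_(i <- A) c f i *: psi i.

Definition quasi_greedy (R : realType) (V : lmodType R) (X : set V)
    (norm : V -> R) (J : choiceType) (psi : J -> V) (c : V -> J -> R) : Prop :=
  exists K : R, forall (f g : V) (n : nat), X f -> (1 <= n)%N ->
    greedy_approximant psi c n f g -> norm g <= K * norm f.

(* Main.v *)
Require Import Defs.
From mathcomp Require Import all_boot all_order all_algebra finmap.
From mathcomp Require Import all_classical all_reals all_analysis.
From mathcomp Require Import measurable_realfun lra zify.

(** The failure is already visible on the concentrating corner bumps
    f_N = 2^(N d) 1_(Q_N), where Q_n = [0, 2^-n)^d, all of norm 1.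

    Fix one type j of Haar function and write h_n for the Haar function of this
    type on the cube Q_n. On the smaller cube Q_(n+1) it is the constant
    2^(n d), so the coefficient of f_N along h_n is 1 for every n < N
    ([haar_coef_bump]). No coefficient of f_N is larger than that: |h_I| is at
    most 1 / mu(I), hence every coefficient functional has norm at most 1
    ([normr_haar_coef]). So any M of the h_n with n < N form a greedy set.

    Consecutive levels could cancel, as they do in the complete expansion of
    f_N; the trick is to keep only the even levels n = 0, 2, ..., 2M - 2 with
    N = 2M. On the shell Q_(2m+1) minus Q_(2m+2) the function h_(2m) has its
    constant positive value 2^(2m d), the earlier even levels are positive
    there too and the later ones vanish, so nothing cancels
    ([lacunary_shell]). The shell has measure at least 2^-((2m+1) d) / 2, hence
    contributes at least 2^-d / 2 to the norm, a bound independent of m. The M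
    shells are disjoint, so the greedy approximant has norm at least
    M 2^-d / 2 ([L1norm_lacunary]), while the norm of f_N stays equal to 1. *)

Set Implicit Arguments.
Unset Strict Implicit.
Unset Printing Implicit Defensive.

Import Order.TTheory GRing.Theory Num.Theory numFieldNormedType.Exports.

Local Open Scope classical_set_scope.
Local Open Scope ring_scope.

(** * Boxes and integrals in the unit cube *)

Section Boxes.
Context (R : realType) (d : nat).
Local Notation mu := (lebesgue_euclidean R d).

Lemma measurable_box (A : 'I_d -> set (measurableTypeR R)) :
  (forall k, measurable (A k)) ->
  measurable [set x : euclidean R d | forall k, A k (tnth x k)].
Proof.
move=> mA.
rewrite (_ : [set _ | _] =
    \bigcap_(k in [set: 'I_d]) ((fun x => tnth x k) @^-1` A k)).
  apply: fin_bigcap_measurable => // k _.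
  by rewrite -[X in measurable X]setTI; exact: measurable_tnth.
by apply/seteqP; split=> [x xA k _|x xA k]; exact: xA.
Qed.

Lemma measurable_unit_cube : measurable (unit_cube R d).
Proof.
exact: (@measurable_box (fun=> [set` `[0, 1]])) => k.
Qed.

Lemma measure_unit_cube : mu (unit_cube R d) = 1%E.
Proof.
have := @lebesgue_euclidean_box R d (fun=> [set` `[0, 1]])
  (fun=> measurable_itv _).
rewrite big1 => [<-//|k _].
by rewrite lebesgue_measure_itv /= lte_fin ltr01 oppr0 adde0.
Qed.

Lemma dyadic_width n (k : 'I_(2 ^ n)) :
  dyadic_hi R k - dyadic_lo R k = (2 ^+ n)^-1.
Proof.
by rewrite /dyadic_hi /dyadic_lo -natr1 mulrDl mul1r addrAC subrr add0r.
Qed.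

Lemma dyadic_lt n (k : 'I_(2 ^ n)) : dyadic_lo R k < dyadic_hi R k.
Proof. by rewrite -subr_gt0 dyadic_width invr_gt0 exprn_gt0. Qed.

Lemma measurable_dyadic_cube n (Q : {ffun 'I_d -> 'I_(2 ^ n)}) :
  measurable (dyadic_cube R Q).
Proof.
exact: (@measurable_box
  (fun k => [set` `[dyadic_lo R (Q k), dyadic_hi R (Q k)[])) => k.
Qed.

Lemma measure_dyadic_cube n (Q : {ffun 'I_d -> 'I_(2 ^ n)}) :
  mu (dyadic_cube R Q) = (((2 ^+ n)^-1) ^+ d)%:E.
Proof.
have := @lebesgue_euclidean_box R d
  (fun k => [set` `[dyadic_lo R (Q k), dyadic_hi R (Q k)[])
  (fun=> measurable_itv _).
rewrite (eq_bigr (fun=> ((2 ^+ n)^-1)%:E)) => [->|k _].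
  by rewrite -[in RHS](card_ord d) -prodr_const -prodEFin.
by rewrite lebesgue_measure_itv /= lte_fin dyadic_lt -EFinD dyadic_width.
Qed.

Lemma dyadic_cube_sub n (Q : {ffun 'I_d -> 'I_(2 ^ n)}) :
  dyadic_cube R Q `<=` unit_cube R d.
Proof.
move=> x Qx k; have := Qx k; rewrite !in_itv /= => /andP[lo hi].
rewrite (le_trans _ lo) ?divr_ge0 ?exprn_ge0//=.
rewrite (le_trans (ltW hi))// ler_pdivrMr ?exprn_gt0// mul1r -natrX ler_nat.
exact: ltn_ord.
Qed.

Lemma L1_bounded (C : R) (f : euclidean R d -> R) :
  measurable_fun setT f -> (forall x, `|f x| <= C) -> L1 R d f.
Proof.
move=> mf fC; apply: measurable_bounded_integrable.
- exact: measurable_unit_cube.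
- by rewrite [X in (X < _)%E]measure_unit_cube ltry.
- exact: measurable_funS mf.
- exists C; split; first by rewrite num_real.
  by move=> y Cy x _; exact: le_trans (fC x) (ltW Cy).
Qed.

Lemma L1_integrable_sub (f : euclidean R d -> R) (A : set (euclidean R d)) :
  L1 R d f -> measurable A -> A `<=` unit_cube R d ->
  mu.-integrable A (EFin \o f).
Proof. by move=> Lf mA /integrableS; apply=> //; exact: measurable_unit_cube. Qed.

(** In the extended integral, additivity over a disjoint union and monotonicity
    in the domain need only nonnegativity; integrability brings the result back
    to [R]. *)
Lemma sum_Rintegral_le_L1norm (f : euclidean R d -> R)
    (S : nat -> set (euclidean R d)) (M : nat) :
  L1 R d f -> (forall m, measurable (S m)) -> trivIset setT S ->
  (forall m, S m `<=` unit_cube R d) ->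
  \sum_(m < M) \int[mu]_(x in S m) `|f x| <= L1norm R d f.
Proof.
move=> Lf mS tS Sc; have mc := measurable_unit_cube.
have Lnf : L1 R d (Num.norm \o f) by exact: integrable_norm.
have fin A : measurable A -> A `<=` unit_cube R d ->
    (\int[mu]_(x in A) (`|f x|)%:E)%E = (\int[mu]_(x in A) `|f x|)%:E.
  move=> mA Ac; rewrite fineK//; apply: integrable_fin_num => //.
  exact: L1_integrable_sub Lnf mA Ac.
rewrite -lee_fin -sumEFin /L1norm -(fin (unit_cube R d))//.
under eq_bigr do rewrite -fin//.
rewrite -(big_mkord xpredT (fun m => \int[mu]_(x in S m) (`|f x|)%:E)%E).
have mf A (Ac : A `<=` unit_cube R d) :=
  measurable_funS mc Ac (measurable_int _ Lnf).
have US : \big[setU/set0]_(0 <= m < M) S m `<=` unit_cube R d.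
  by rewrite big_mkord -bigcup_mkord => x [m _] /Sc.
rewrite -ge0_integral_bigsetU//.
- apply: ge0_subset_integral => //.
  + by rewrite big_mkord; exact: bigsetU_measurable.
  + exact: mf.
- exact: iota_uniq.
- exact: sub_trivIset tS.
- exact: mf.
Qed.

Lemma Rintegral_le_L1norm (f : euclidean R d -> R) (A : set (euclidean R d)) :
  L1 R d f -> measurable A -> A `<=` unit_cube R d ->
  \int[mu]_(x in A) `|f x| <= L1norm R d f.
Proof.
move=> Lf mA Ac.
pose S m : set (euclidean R d) := if m is 0%N then A else set0.
have := @sum_Rintegral_le_L1norm f S 1 Lf; rewrite big_ord1/=; apply.
- by case=> [|m]; [exact: mA|exact: measurable0].
- by move=> [|m] [|m'] _ _ //= [x []].
- by case=> [|m]; [exact: Ac|exact: sub0set].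
Qed.

Lemma Rintegral_indicZ (c : R) (A B : set (euclidean R d)) :
  measurable A -> measurable B -> A `<=` B -> B `<=` unit_cube R d ->
  \int[mu]_(x in B) (c * \1_A x) = c * fine (mu A).
Proof.
move=> mA mB AB Bc.
have L : L1 R d (\1_A : _ -> R).
  apply: (@L1_bounded 1); first exact: measurable_indic.
  by move=> x; rewrite indicE; case: (_ \in _); rewrite ?normr1 ?normr0.
rewrite RintegralZl//; last exact: L1_integrable_sub.
congr (_ * fine _); rewrite -[in RHS](setIidl AB).
exact: integral_indic.
Qed.

End Boxes.

(** * Haar functions and their coefficients *)

Section Haar.
Context (R : realType) (d : nat).
Local Notation mu := (lebesgue_euclidean R d).

Lemma normr_haar_factor e (a b x : R) : a < b ->
  `|haar_factor e a b x| <= (b - a)^-1.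
Proof.
move=> ab; have ba : 0 < (b - a)^-1 by rewrite invr_gt0 subr_gt0.
(* The factor is (b - a)^-1 times a number t equal to 1, 0 or -1. *)
suff [t -> tP] : exists2 t, haar_factor e a b x = t * (b - a)^-1 & `|t| <= 1.
  by rewrite normrM (gtr0_norm ba) -[leRHS]mul1r ler_wpM2r// ltW.
case: e => /=; eexists; try reflexivity; rewrite !indicE !mem_setE.
  rewrite !in_itv /=; have [h|h] := ltP x ((a + b) / 2).
    by rewrite andbT /=; case: (a <= x); rewrite /= ?subr0 ?normr1 ?normr0.
  by rewrite andbF /=; case: (x < b); rewrite /= ?sub0r ?normrN ?normr1 ?normr0.
by case: (x \in _); rewrite ?normr1 ?normr0.
Qed.

(** The two types of factor agree on the left half of the interval; this is why
    all Haar functions on a cube take the same value on its lowest subcube,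
    whatever their type. *)
Lemma haar_factor_lhalf e (a b x : R) : a < b -> x \in `[a, (a + b) / 2[ ->
  haar_factor e a b x = (b - a)^-1.
Proof.
move=> ab; rewrite in_itv /= => /andP[ax xm].
have xb : x < b by lra.
case: e; rewrite /haar_factor !indicE !mem_setE !in_itv /= ax ?xm ?xb /=.
  by rewrite leNgt xm /= subr0 mul1r.
by rewrite mul1r.
Qed.

Lemma haar_factor_out e (a b x : R) : a < b -> x \notin `[a, b[ ->
  haar_factor e a b x = 0.
Proof.
move=> ab; rewrite in_itv /= negb_and -ltNge -leNgt => /orP h.
case: e; rewrite /haar_factor !indicE !mem_setE !in_itv /=.
  have -> : (a <= x < (a + b) / 2) = false by apply/negP => /andP[]; case: h; lra.
  have -> : ((a + b) / 2 <= x < b) = false by apply/negP => /andP[]; case: h; lra.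
  by rewrite subr0 mul0r.
have -> : (a <= x < b) = false by apply/negP => /andP[]; case: h; lra.
by rewrite mul0r.
Qed.

Lemma measurable_haar_factor e (a b : R) :
  measurable_fun [set: measurableTypeR R] (haar_factor e a b).
Proof.
by case: e; apply: measurable_funM => //; try apply: measurable_funB;
  exact: measurable_indic.
Qed.

Lemma measurable_haar (i : haar_index d) : measurable_fun setT (haar R i).
Proof.
case: i => [[n [Q j]]|] /=.
  apply: measurable_prod => k _.
  exact: (measurableT_comp (@measurable_haar_factor _ _ _) (measurable_tnth k)).
apply: measurable_indic.
exact: (@measurable_box R d (fun=> [set` `[0, 1[])) => k.
Qed.

Lemma normr_haar n (Q : {ffun 'I_d -> 'I_(2 ^ n)})
    (j : {j : 'I_(2 ^ d) | (0 < j)%N}) x :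
  `|haar R (Some (existT _ n (Q, j))) x| <= (2 ^+ n) ^+ d.
Proof.
rewrite /= normr_prod -[in leRHS](card_ord d) -prodr_const.
apply: ler_prod => k _; rewrite normr_ge0/=.
by rewrite -[leRHS]invrK -(dyadic_width R (Q k)) normr_haar_factor// dyadic_lt.
Qed.

Lemma haar_L1 (i : haar_index d) : L1 R d (haar R i).
Proof.
case: i => [[n [Q j]]|].
  exact: L1_bounded (@measurable_haar _) (normr_haar Q j).
apply: (@L1_bounded _ _ 1); first exact: measurable_haar.
by move=> x; rewrite /= indicE; case: (_ \in _); rewrite ?normr1 ?normr0.
Qed.

(** The factor mu(Q) in the definition of the coefficient exactly compensates the
    bound 1 / mu(Q) on the Haar function. *)
Lemma normr_haar_coef (f : euclidean R d -> R) (i : haar_index d) :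
  L1 R d f -> `|haar_coef R f i| <= L1norm R d f.
Proof.
move=> Lf; have mc := @measurable_unit_cube R d.
case: i => [[n [Q j]]|]; last exact: le_normr_Rintegral.
have mQ := @measurable_dyadic_cube R d n Q; have Qc := @dyadic_cube_sub R d n Q.
set h := haar R (Some (existT _ n (Q, j))).
set w : R := ((2 ^+ n) ^+ d).
have w0 : 0 < w by rewrite exprn_gt0// exprn_gt0.
have hw x : `|h x| <= w by exact: normr_haar.
have fQ := L1_integrable_sub Lf mQ Qc.
have fhQ : mu.-integrable (dyadic_cube R Q) (EFin \o (fun x => f x * h x)).
  apply: (integrableMl mQ fQ (h := h)).
    by apply: measurable_funS (measurable_haar _).
  exists w; split; first by rewrite num_real.
  by move=> y wy x _; exact: le_trans (hw x) (ltW wy).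
rewrite /= measure_dyadic_cube /= exprVn -/w normrM gtr0_norm ?invr_gt0//.
rewrite mulrC ler_pdivrMr//.
apply: (le_trans (le_normr_Rintegral mQ fhQ)).
have nfQ := integrable_norm fQ.
apply: (@le_trans _ _ (\int[mu]_(x in dyadic_cube R Q) (`|f x| * w))).
  apply: le_Rintegral => //.
  - exact: (integrable_norm fhQ).
  - exact: (integrableZr mQ w nfQ).
  - by move=> x _; rewrite normrM ler_wpM2l.
rewrite (RintegralZr w mQ nfQ) ler_wpM2r ?(ltW w0)//.
exact: Rintegral_le_L1norm.
Qed.

End Haar.

(** * Cubes, Haar functions and bumps at the origin *)

Section Corner.
Context (R : realType) (d : nat).
Local Notation mu := (lebesgue_euclidean R d).

Definition corner n : {ffun 'I_d -> 'I_(2 ^ n)} :=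
  [ffun=> Ordinal (expn_gt0 2 n : (0 < 2 ^ n)%N)].

Definition corner_cube n : set (euclidean R d) := dyadic_cube R (corner n).

Lemma corner_cubeE n :
  corner_cube n = [set x | forall k, tnth x k \in `[0, (2 ^+ n)^-1[].
Proof.
by apply/seteqP; split => x /= xP k; have := xP k;
  rewrite ffunE /dyadic_lo /dyadic_hi /= mul0r mul1r.
Qed.

Lemma subset_corner_cube m n : (m <= n)%N -> corner_cube n `<=` corner_cube m.
Proof.
move=> mn; rewrite !corner_cubeE => x /= xP k; move: (xP k).
rewrite !in_itv /= => /andP[->/= /lt_le_trans]; apply.
by rewrite lef_pV2 ?posrE ?exprn_gt0// ler_eXn2l// ltr1n.
Qed.

Lemma measure_corner_cube n : mu (corner_cube n) = (((2 ^+ n)^-1) ^+ d)%:E.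
Proof. exact: measure_dyadic_cube. Qed.

Context (j : {j : 'I_(2 ^ d) | (0 < j)%N}).

Definition corner_index n : haar_index d := Some (existT _ n (corner n, j)).

(** The lowest of the 2^d subcubes of the corner cube of level n is the corner
    cube of level n + 1. *)
Lemma haar_corner_in n x : corner_cube n.+1 x ->
  haar R (corner_index n) x = (2 ^+ n) ^+ d.
Proof.
rewrite corner_cubeE => xP /=.
rewrite -[in RHS](card_ord d) -prodr_const; apply: eq_bigr => k _.
rewrite haar_factor_lhalf ?dyadic_lt//.
  by rewrite dyadic_width invrK.
rewrite ffunE /dyadic_lo /dyadic_hi /= mul0r mul1r add0r -invfM -exprSr.
exact: xP.
Qed.

Lemma haar_corner_out n x : ~ corner_cube n x -> haar R (corner_index n) x = 0.
Proof.
move=> /existsNP[k xk]; rewrite /= (bigD1 k)//= haar_factor_out ?mul0r//.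
  exact: dyadic_lt.
by apply/negP.
Qed.

Definition bump N : euclidean R d -> R :=
  fun x => (2 ^+ N) ^+ d * \1_(corner_cube N) x.

Lemma bump_L1 N : L1 R d (bump N).
Proof.
apply: (@L1_bounded _ _ ((2 ^+ N) ^+ d)).
  apply: measurable_funM => //; apply: measurable_indic.
  exact: measurable_dyadic_cube.
move=> x; rewrite /bump indicE; case: (_ \in _) => /=.
  by rewrite mulr1 ger0_norm// exprn_ge0// exprn_ge0.
by rewrite mulr0 normr0 exprn_ge0// exprn_ge0.
Qed.

Lemma Rintegral_bump N (B : set (euclidean R d)) : measurable B ->
  corner_cube N `<=` B -> B `<=` unit_cube R d ->
  \int[mu]_(x in B) bump N x = 1.
Proof.
move=> mB NB Bc; rewrite Rintegral_indicZ//; last exact: measurable_dyadic_cube.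
by rewrite measure_dyadic_cube /= exprVn mulfV// expf_neq0// expf_neq0.
Qed.

Lemma L1norm_bump N : L1norm R d (bump N) = 1.
Proof.
rewrite -(@Rintegral_bump N (unit_cube R d))//.
- apply: eq_Rintegral => x _; by rewrite ger0_norm// mulr_ge0.
- exact: measurable_unit_cube.
- exact: dyadic_cube_sub.
Qed.

(** The bump sits inside the region where the Haar function is constant, so the
    integral is that constant times the mass 1 of the bump. *)
Lemma haar_coef_bump N n : (n < N)%N ->
  haar_coef R (bump N) (corner_index n) = 1.
Proof.
move=> nN; rewrite [haar_coef _ _ _]/=.
have mQ := @measurable_dyadic_cube R d n (corner n).
have Qc := @dyadic_cube_sub R d _ (corner n).
rewrite measure_dyadic_cube [fine _]/=.
rewrite (eq_Rintegral _ (g := fun x => (2 ^+ n) ^+ d * bump N x)); last first.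
  move=> x _; rewrite /bump indicE.
  have [|] := boolP (x \in corner_cube N); last by rewrite !(mulr0, mul0r).
  move=> /set_mem /(subset_corner_cube nN) /haar_corner_in /= ->.
  by rewrite mulrC.
rewrite RintegralZl//; last exact: L1_integrable_sub (bump_L1 N) mQ Qc.
rewrite Rintegral_bump//; last exact: subset_corner_cube (ltnW nN).
by rewrite mulr1 exprVn mulVf// expf_neq0// expf_neq0.
Qed.

(** * Shells and the lacunary sum *)

(** The part of the lowest subcube of the corner cube of level 2m that the corner
    Haar functions of all later even levels miss. *)
Definition shell m : set (euclidean R d) :=
  corner_cube m.*2.+1 `\` corner_cube m.*2.+2.

Lemma measurable_shell m : measurable (shell m).
Proof. by apply: measurableD; exact: measurable_dyadic_cube. Qed.

Lemma shell_sub m : shell m `<=` unit_cube R d.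
Proof. by move=> x [/dyadic_cube_sub]. Qed.

Lemma trivIset_shell : trivIset setT shell.
Proof.
suff lt m m' x : (m < m')%N -> shell m x -> ~ shell m' x.
  apply/trivIsetP => m m' _ _; rewrite neq_ltn => /orP[] h.
    by apply/seteqP; split => // x [] /(lt _ _ _ h).
  by apply/seteqP; split => // x [] /[swap] /(lt _ _ _ h).
move=> mm' [_ xm] [xm' _]; apply/xm/subset_corner_cube/xm'.
by lia.
Qed.

(** Here d > 0 gives that removing the next corner cube, a fraction 2^-d of the
    volume, leaves at least half of it. *)
Lemma measure_shell m : (0 < d)%N ->
  ((2 ^+ m.*2.+1) ^+ d)^-1 / 2 <= fine (mu (shell m)).
Proof.
move=> d0; rewrite measureD//; last 3 first.
- exact: measurable_dyadic_cube.
- exact: measurable_dyadic_cube.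
- apply: le_lt_trans (ltry (((2 ^+ m.*2.+1)^-1) ^+ d)).
  by rewrite -measure_corner_cube.
rewrite setIidr; last exact: subset_corner_cube.
rewrite [X in fine (X - _)]measure_corner_cube.
rewrite [X in fine (_ - X)]measure_corner_cube/=.
rewrite [2 ^+ m.*2.+2]exprSr invfM exprMn !exprVn.
set w := _^-1; have w0 : 0 <= w by rewrite invr_ge0 exprn_ge0// exprn_ge0.
have d2 : (2 ^+ d)^-1 <= 2^-1 :> R.
  rewrite lef_pV2 ?posrE ?exprn_gt0//.
  by rewrite -[leLHS]expr1 ler_eXn2l// ltr1n.
nra.
Qed.

Definition lacunary M : euclidean R d -> R :=
  fun x => \sum_(m < M) haar R (corner_index m.*2) x.

Lemma lacunary_L1 M : L1 R d (lacunary M).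
Proof.
apply: (eq_integrable (@measurable_unit_cube R d)
  (fun x => \sum_(m < M) (haar R (corner_index m.*2) x)%:E)%E).
  by move=> x _; rewrite /= sumEFin.
apply: integrable_sum; first exact: measurable_unit_cube.
by move=> m _; exact: haar_L1.
Qed.

(** Every term is nonnegative at x: an earlier level k < m has x in its lowest
    subcube because 2k + 1 <= 2m + 1, and a later level k > m has x outside its
    support because 2m + 2 <= 2k. Skipping the odd levels leaves exactly this
    room. *)
Lemma lacunary_shell M (m : 'I_M) x : shell m x ->
  (2 ^+ m.*2) ^+ d <= `|lacunary M x|.
Proof.
move=> [xm xm']; rewrite (le_trans _ (ler_norm _))// /lacunary (bigD1 m)//.
rewrite haar_corner_in// lerDl sumr_ge0// => k km.
have [mk|kpm] := ltnP m k.
  rewrite haar_corner_out// => xk; apply/xm'/subset_corner_cube/xk.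
  by lia.
rewrite haar_corner_in ?exprn_ge0 ?exprn_ge0//.
by apply: subset_corner_cube xm; lia.
Qed.

(** On each shell the height 2^(2m d) compensates the volume up to the factor
    2^-d / 2, so every shell contributes at least that much, whatever m. *)
Lemma L1norm_lacunary M : (0 < d)%N ->
  M%:R * ((2 ^+ d)^-1 / 2) <= L1norm R d (lacunary M).
Proof.
move=> d0.
apply: le_trans (sum_Rintegral_le_L1norm M (lacunary_L1 M) measurable_shell
  trivIset_shell shell_sub).
rewrite -[in M%:R](card_ord M) -sumr_const mulr_suml.
apply: ler_sum => m _; rewrite mul1r.
set w : R := (2 ^+ m.*2) ^+ d.
have w0 : 0 < w by rewrite exprn_gt0// exprn_gt0.
apply: (@le_trans _ _ (w * fine (mu (shell m)))).
  have := measure_shell m d0; rewrite exprSr exprMn -/w invfM => h.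
  rewrite -ler_pdivrMl//; apply: le_trans h; by rewrite !mulrA.
have mS := measurable_shell m; have Sc := @shell_sub m.
have nL : L1 R d (Num.norm \o lacunary M).
  exact: integrable_norm (lacunary_L1 M).
rewrite -Rintegral_cst//; apply: le_Rintegral => //.
- apply: (L1_integrable_sub (f := cst w)) => //.
  by apply: (@L1_bounded _ _ `|w|).
- exact: L1_integrable_sub nL mS Sc.
- by move=> x; exact: lacunary_shell.
Qed.

(** The selected coefficients are all 1, which is the norm of the bump and hence
    an upper bound for all the others. *)
Lemma lacunary_greedy M :
  greedy_approximant (@haar R d) (@haar_coef R d) M (bump M.*2) (lacunary M).
Proof.
have inj : injective (fun m : 'I_M => corner_index m.*2).
  move=> m m' [] /double_inj mm' _; exact/val_inj.
have coef (m : 'I_M) : haar_coef R (bump M.*2) (corner_index m.*2) = 1.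
  by apply: haar_coef_bump; rewrite ltn_double.
exists [fset corner_index (m : 'I_M).*2 | m in 'I_M]%fset.
  split; first by rewrite card_imfset//= -cardE card_ord.
  move=> i i' /imfsetP[m _ im] _; rewrite {}im (coef m) normr1.
  by rewrite -(L1norm_bump M.*2); exact/normr_haar_coef/bump_L1.
rewrite big_imfset; last by move=> ? ? _ _; exact: inj.
rewrite big_enum (eq_bigr (fun m : 'I_M => haar R (corner_index m.*2))).
  by apply/funext => x; rewrite fct_sumE.
by move=> m _; rewrite (coef m) scale1r.
Qed.

End Corner.

Theorem corollary8p1 (R : realType) (d : nat) (hd : (1 <= d)%N) :
  ~ quasi_greedy (L1 R d) (L1norm R d) (@haar R d) (@haar_coef R d).
Proof.
move=> [K qg].
have j1 : (1 < 2 ^ d)%N by rewrite -[1%N]/(2 ^ 0)%N ltn_exp2l.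
(* Any type will do; j = 1 is one for every d > 0. *)
pose j : {j : 'I_(2 ^ d) | (0 < j)%N} := exist _ (Ordinal j1) isT.
pose c : R := (2 ^+ d)^-1 / 2.
have c0 : 0 < c by rewrite divr_gt0// invr_gt0 exprn_gt0.
pose M := (Num.bound `|K / c|).+1.
have := qg _ _ M (bump_L1 _ _ _) isT (lacunary_greedy R j M).
rewrite L1norm_bump mulr1 => /(le_trans (L1norm_lacunary R j M hd)).
rewrite -/c -ler_pdivlMr// leNgt => /negP; apply.
apply: (le_lt_trans (ler_norm _)); apply: (lt_le_trans (archi_boundP _)) => //.
by rewrite ler_nat.
Qed.
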